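(* Let $p$ be a prime, let $d\geq1$ be an integer, and let $E\subseteq\mathbb{C}$ be any set invariant under rotation, that is, $e^{i\varphi}E=E$ for all $\varphi\in\mathbb{R}$. Let $F(p,\cdot)$ be a function of a real variable such that for every function $h\colon\mathbb{Z}_p\to E\cup\{0\}$ with $|\operatorname{supp}h|=\delta p<(2p)^{1/2}$ the bound $$\|\hat h\|_1\geq F(p,\delta)$$ holds. Then for every function $f\colon\mathbb{Z}_p^d\to E\cup\{0\}$ with $|\operatorname{supp}f|=\delta p<(2p)^{1/2}$ we have $$\|\hat f\|_1\geq F(p,\delta).$$
   Context: $\mathbb{Z}_p=\mathbb{Z}/p\mathbb{Z}$ and $\operatorname{supp}f=\{x: f(x)\neq0\}$. For $f\colon\mathbb{Z}_p^d\to\mathbb{C}$ (with $d\geq1$; the case $d=1$ is $\mathbb{Z}_p$) the Fourier transform is $\hat f(\xi)=p^{-d}\sum_{x\in\mathbb{Z}_p^d}f(x)e^{-2\pi i(\xi_1x_1+\dots+\xi_dx_d)/p}$ for $\xi\in\mathbb{Z}_p^d$, and the Wiener norm of $f$ is $\|\hat f\|_1=\sum_{\xi\in\mathbb{Z}_p^d}|\hat f(\xi)|$. In both the hypothesis and the conclusion, $\delta$ denotes the size of the support divided by $p$ (not by $p^d$). *)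

(* Defs.v *)
(* C is R[i] over an arbitrary R : realType. *)
From HB Require Import structures.
From mathcomp Require Import all_boot all_order all_algebra.
From mathcomp Require Import complex.
From mathcomp Require Import boolp classical_sets reals trigo.

Set Implicit Arguments.
Unset Strict Implicit.
Unset Printing Implicit Defensive.

Import Order.TTheory GRing.Theory Num.Theory.
Local Open Scope ring_scope.
Local Open Scope complex_scope.

Definition expi (R : realType) (t : R) : R[i] := cos t +i* sin t.

Definition rotation_invariant (R : realType) (E : set R[i]) : Prop :=
  forall phi : R, ([set expi phi * z | z in E] = E)%classic.

(* Z_p^d is 'rV['F_p]_d; 'F_p is Z/pZ only when p is prime. The coordinates are
   taken as their representatives in {0, .., p-1}; the exponential below does
   not depend on the choice of representatives. *)
Definition dotF (p d : nat) (xi x : 'rV['F_p]_d) : nat :=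
  (\sum_(j < d) (xi 0%R j : nat) * (x 0%R j : nat))%N.

Definition fourier (R : realType) (p d : nat) (f : 'rV['F_p]_d -> R[i])
    (xi : 'rV['F_p]_d) : R[i] :=
  (p%:R ^+ d)^-1 *
  \sum_(x : 'rV['F_p]_d) f x * expi (- (2 * pi * (dotF xi x)%:R / p%:R)).

(* [normc] is the R-valued modulus, whereas `|z| lives in R[i]. *)
Definition wiener_norm (R : realType) (p d : nat) (f : 'rV['F_p]_d -> R[i]) : R :=
  \sum_(xi : 'rV['F_p]_d) ComplexField.Normc.normc (fourier f xi).

Definition supp_size (R : realType) (p d : nat) (f : 'rV['F_p]_d -> R[i]) : nat :=
  #|[pred x | f x != 0]|.

(* Main.v *)
Require Import Defs.
From mathcomp Require Import all_boot all_order all_algebra.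
From mathcomp Require Import complex.
From mathcomp Require Import boolp classical_sets reals trigo.

Import Order.TTheory GRing.Theory Num.Theory.
Local Open Scope ring_scope.

(** The idea is to push [f] forward to [Z_p] along a linear functional
    [x |-> x . a], after twisting it by a character.

    Put [h_b(y) = \sum_(x . a = y) f(x) chi(x . b)]. Its Fourier transform is
    that of [f], scaled by [p^(d-1)] and restricted to the line
    [{b + eta a}] ([fourier_pushforward]). As [b] runs over [Z_p^d] these lines
    cover the frequency space uniformly, so that the average over [b] of the
    Wiener norms of the [h_b] is exactly the Wiener norm of [f]
    ([sum_wiener_pushforward]). It is thus enough that every [h_b] satisfies
    the one-dimensional bound with the same [delta].

    This holds as soon as [x |-> x . a] is injective on [supp f]: then each
    nonzero value of [h_b] is a single value of [f] times a complex number of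
    modulus one, hence in [E], and the supports of [h_b] and [f] are
    equinumerous. Such an [a] exists by counting ([separating_functional]): a
    pair of distinct points of [supp f] is merged by only [p^(d-1)] of the
    [p^d] functionals, and the condition [|supp f|^2 < 2p] leaves fewer than
    [p] pairs. *)

Section SeparatingFunctional.

Variables (F : finFieldType) (n : nat).
Implicit Types (v a x y : 'rV[F]_n) (S : {set 'rV[F]_n}).

(** Moving [a] along a coordinate axis on which [v] does not vanish changes
    [v . a] injectively, so the annihilator of [v] has [#|F|] disjoint
    translates. *)
Lemma card_annihilator v : v != 0 ->
  (#|[set a : 'rV[F]_n | v *m a^T == 0%R]| * #|F| <= #|F| ^ n)%N.
Proof.
move=> /rV0Pn[j vj].
set K := [set a | _].
pose g (u : 'rV[F]_n * F) := u.1 + u.2 *: delta_mx 0 j.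
have g_inj : {in finset.setX K [set: F] &, injective g}.
  move=> [a c] [a' c']; rewrite !inE /= !andbT => /eqP Ka /eqP Ka' eq_g.
  have eq_c : c = c'.
    have dotg b e : (v *m (g (b, e))^T) 0 0 = (v *m b^T) 0 0 + e * v 0 j.
      rewrite /g /= linearD /= linearZ /= trmx_delta mulmxDr -scalemxAr mxE.
      by rewrite -colE !mxE.
    have := congr1 (fun w => (v *m w^T) 0 0) eq_g.
    by rewrite /= !dotg Ka Ka' mxE !add0r => /(mulIf vj).
  by move: eq_g; rewrite /g /= eq_c => /addIr ->.
rewrite -[#|F|]cardsT -cardsX -(card_in_imset g_inj).
by rewrite (leq_trans (max_card _)) // card_mx mul1n cardsT.
Qed.

(** A union bound over the pairs of points of [S]: if every functional merged
    some pair, the [#|F| ^ n] functionals would be covered by ['C(#|S|, 2)]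
    annihilators of size at most [#|F| ^ n.-1] each. *)
Lemma separating_functional S : ('C(#|S|, 2) < #|F|)%N ->
  exists a, {in S &, injective (fun x => x *m a^T)}.
Proof.
move=> few_pairs.
pose pairs := [set T : {set 'rV[F]_n} | T \subset S & #|T| == 2].
pose merging (T : {set 'rV[F]_n}) :=
  [set a : 'rV[F]_n |
    [exists x in T, exists y in T, (x != y) && (x *m a^T == y *m a^T)]].
have card_merging T : T \in pairs -> (#|merging T| * #|F| <= #|F| ^ n)%N.
  rewrite inE => /andP[_ /cards2P[x [y [neq_xy ->]]]].
  (* A functional merging [x] and [y] annihilates [x - y]. *)
  have nz : x - y != 0 by rewrite subr_eq0.
  apply: leq_trans (card_annihilator _ nz).
  rewrite leq_mul2r subset_leq_card ?orbT //.
  apply/fintype.subsetP=> a; rewrite !inE.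
  move=> /existsP[x' /andP[Tx' /existsP[y' /and3P[Ty' neq' eq_a]]]].
  rewrite mulmxBl subr_eq0; move: Tx' Ty' neq' eq_a; rewrite !inE.
  by move=> /orP[]/eqP-> /orP[]/eqP->; rewrite ?eqxx // => _; rewrite eq_sym.
have [cover|] := boolP [forall a, [exists T in pairs, a \in merging T]].
  have : (#|F| ^ n <= \sum_(T in pairs) #|merging T|)%N.
    have -> : (#|F| ^ n = #|[set: 'rV[F]_n]|)%N by rewrite cardsT card_mx mul1n.
    have -> : [set: 'rV[F]_n] = \bigcup_(T in pairs) merging T.
      apply/esym/setP=> a; rewrite inE; apply/bigcupP.
      by have /existsP[T /andP[PT aT]] := forallP cover a; exists T.
    elim/big_rec2: _ => [|T m A _ leAm]; first by rewrite cards0.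
    by rewrite (leq_trans (leq_card_setU _ _)) // leq_add2l.
  have F_gt0 : (0 < #|F| ^ n)%N.
    by rewrite expn_gt0; apply/orP; left; apply/card_gt0P; exists 0.
  rewrite -(leq_pmul2r (leq_ltn_trans (leq0n _) few_pairs)) big_distrl.
  move=> /leq_trans /(_ (leq_sum _ card_merging)).
  by rewrite sum_nat_const cards_draws mulnC leq_pmul2r // leqNgt few_pairs.
rewrite negb_forall => /existsP[a /existsP a_sep]; exists a => x y Sx Sy eq_a.
apply/eqP; apply: contraT => neq_xy; case: a_sep; exists [set x; y].
rewrite !inE cards2 neq_xy eqxx andbT; apply/andP; split.
  by apply/fintype.subsetP=> z; rewrite !inE => /orP[]/eqP->.
apply/existsP; exists x; rewrite set21; apply/existsP; exists y.
by rewrite set22 neq_xy; apply/eqP.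
Qed.

End SeparatingFunctional.

Section Characters.

Set Implicit Arguments.
Unset Strict Implicit.

Variable R : realType.
Implicit Types s t : R.

Lemma expiD s t : expi (s + t) = expi s * expi t.
Proof.
by rewrite /expi cosD sinD; simpc; rewrite [sin s * cos t + _]addrC.
Qed.

Lemma expi0 : expi 0 = 1 :> R[i].
Proof. by rewrite /expi cos0 sin0. Qed.

Lemma expi_neq0 t : expi t != 0.
Proof.
apply/negP=> /eqP t0; have := expiD t (- t).
by rewrite subrr expi0 t0 mul0r => /eqP; rewrite oner_eq0.
Qed.

Lemma expi_periodic n t : expi (t + (pi *+ 2) *+ n) = expi t.
Proof. by rewrite /expi (periodicn (@cosD2pi R)) (periodicn (@sinD2pi R)). Qed.

Variable p : nat.
Hypothesis p_prime : prime p.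

(** The standard additive character of [Z_p], composed with conjugation so as
    to match the sign in the kernel of the Fourier transform. *)
Definition chi (c : 'F_p) : R[i] := expi (- (2 * pi * (c : nat)%:R / p%:R)).

(** Representatives of the same residue differ by a multiple of [p], which
    changes the angle by full turns; this lets the integer [dotF] be replaced
    by the inner product in ['F_p]. *)
Lemma chi_natr n : expi (- (2 * pi * n%:R / p%:R)) = chi n%:R.
Proof.
have p0 : p%:R != 0 :> R by rewrite pnatr_eq0 -lt0n prime_gt0.
rewrite /chi val_Fp_nat // -(expi_periodic (n %/ p)) {1}(divn_eq n p).
congr (expi _); rewrite natrD natrM mulrDr mulrDl opprD.
rewrite -[2 * pi * _ / _]mulrA mulfK // addrAC.
by rewrite -[pi *+ 2]mulr_natl [_ * (n %/ p)%:R]mulr_natr addNr add0r.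
Qed.

Lemma chiD (b c : 'F_p) : chi (b + c) = chi b * chi c.
Proof.
rewrite -[b in LHS]natr_Zp -[c in LHS]natr_Zp -natrD -chi_natr /chi -expiD.
by rewrite natrD mulrDr mulrDl opprD.
Qed.

Lemma fourierE d (f : 'rV['F_p]_d -> R[i]) xi :
  fourier f xi = (p%:R ^+ d)^-1 * \sum_x f x * chi ((x *m xi^T) 0 0).
Proof.
congr (_ * _); apply: eq_bigr => x _; rewrite chi_natr; congr (_ * chi _).
rewrite /dotF natr_sum mxE; apply: eq_bigr => j _.
by rewrite natrM !natr_Zp mxE mulrC.
Qed.

Section Pushforward.

Variables (d : nat) (f : 'rV['F_p]_d -> R[i]) (a : 'rV['F_p]_d).

(** The twist by the character of frequency [b] translates the Fourier transform
    of [f]; without it only the line through the origin directed by [a] would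
    be seen. *)
Definition pushforward (b : 'rV['F_p]_d) (y : 'rV['F_p]_1) : R[i] :=
  \sum_(x | x *m a^T == y) f x * chi ((x *m b^T) 0 0).

(** The character of frequency [eta] on [Z_p], composed with [x |-> x . a], is
    the character of frequency [eta a] on [Z_p^d]; the sum over [y] of the sums
    over the fibres is then a single sum over [x]. *)
Lemma fourier_pushforward b eta :
  fourier (pushforward b) eta =
  p%:R^-1 * p%:R ^+ d * fourier f (b + eta 0 0 *: a).
Proof.
have p0 : p%:R ^+ d != 0 :> R[i].
  by rewrite expf_neq0 // pnatr_eq0 -lt0n prime_gt0.
rewrite !fourierE expr1 -!mulrA (mulVKf p0); congr (_ * _).
rewrite [RHS](partition_big (fun x => x *m a^T) predT) //=.
apply: eq_bigr => y _; rewrite mulr_suml; apply: eq_bigr => x /eqP <-.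
rewrite -mulrA -chiD; congr (_ * chi _).
rewrite linearD /= linearZ /= mulmxDr -scalemxAr !mxE.
by congr (_ + _); rewrite big_ord1 !mxE mulrC.
Qed.

(** For a fixed [eta], the frequency [b + eta a] runs once over the whole
    group with [b]; the [p] values of [eta] compensate the [1/p] of the
    one-dimensional transform. *)
Lemma sum_wiener_pushforward :
  \sum_b wiener_norm (pushforward b) = p%:R ^+ d * wiener_norm f.
Proof.
have p0 : p%:R != 0 :> R by rewrite pnatr_eq0 -lt0n prime_gt0.
have normcn n : ComplexField.Normc.normc (n%:R : R[i]) = n%:R.
  by rewrite normcMn ComplexField.Normc.normc1.
rewrite /wiener_norm exchange_big /=.
transitivity (\sum_(eta : 'rV['F_p]_1) p%:R^-1 * p%:R ^+ d * wiener_norm f).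
  apply: eq_bigr => eta _.
  rewrite [X in _ = _ * X](reindex_inj (addIr (eta 0 0 *: a))) mulr_sumr.
  apply: eq_bigr => b _.
  rewrite fourier_pushforward -natrX !ComplexField.Normc.normcM.
  by rewrite ComplexField.Normc.normcV !normcn natrX.
by rewrite sumr_const card_mx card_Fp // -[LHS]mulr_natl !mulrA divff ?mul1r.
Qed.

Hypothesis a_sep : {in [set x | f x != 0] &, injective (fun x => x *m a^T)}.

(** By injectivity the fibre through [x] meets the support of [f] only in [x],
    so the sum over that fibre has no cancellation. *)
Lemma pushforward_at b x : f x != 0 ->
  pushforward b (x *m a^T) = f x * chi ((x *m b^T) 0 0).
Proof.
move=> fx; rewrite /pushforward (bigD1 x) //= big1 ?addr0 // => z.
move=> /andP[/eqP eq_z neq_zx]; have [->|fz] := eqVneq (f z) 0.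
  by rewrite mul0r.
by case/eqP: neq_zx; apply: a_sep; rewrite ?inE.
Qed.

Lemma pushforward_neq0 b y : pushforward b y != 0 ->
  exists2 x, f x != 0 & y = x *m a^T.
Proof.
move=> hy; apply: contrapT => no_x.
case/eqP: hy; apply: big1 => x /eqP def_y; have [->|fx] := eqVneq (f x) 0.
  by rewrite mul0r.
by case: no_x; exists x.
Qed.

Lemma supp_size_pushforward b : supp_size (pushforward b) = supp_size f.
Proof.
have -> : supp_size f = #|[set x | f x != 0]| by rewrite cardsE.
rewrite -(card_in_imset a_sep); apply: eq_card => y; rewrite !inE.
apply/idP/imsetP=> [/pushforward_neq0[x fx ->]|[x]].
  by exists x; rewrite ?inE.
by rewrite inE => fx ->; rewrite pushforward_at // mulf_neq0 // expi_neq0.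
Qed.

(** Here the rotation invariance of [E] absorbs the unimodular twist. *)
Lemma pushforward_range (E : set R[i]) : rotation_invariant E ->
  (forall x, (E `|` [set 0])%classic (f x)) ->
  forall b y, (E `|` [set 0])%classic (pushforward b y).
Proof.
move=> E_rot fE b y; have [->|] := eqVneq (pushforward b y) 0; first by right.
case/pushforward_neq0=> x fx ->.
rewrite pushforward_at //; left.
have Efx : E (f x) by case: (fE x) => // fx0; rewrite fx0 eqxx in fx.
rewrite mulrC /chi; set phi := (X in expi X).
by rewrite -(E_rot phi); exists (f x).
Qed.

End Pushforward.

End Characters.

Theorem theorem4 (R : realType) (p : nat) (p_prime : prime p)
    (d : nat) (d_ge1 : (1 <= d)%N)
    (E : set R[i]) (E_rot : rotation_invariant E)
    (F : nat -> R -> R)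
    (F_bound : forall (h : 'rV['F_p]_1 -> R[i]) (delta : R),
       (forall x, (E `|` [set 0])%classic (h x)) ->
       (supp_size h)%:R = delta * p%:R ->
       delta * p%:R < Num.sqrt (2 * p%:R) ->
       F p delta <= wiener_norm h) :
  forall (f : 'rV['F_p]_d -> R[i]) (delta : R),
    (forall x, (E `|` [set 0])%classic (f x)) ->
    (supp_size f)%:R = delta * p%:R ->
    delta * p%:R < Num.sqrt (2 * p%:R) ->
    F p delta <= wiener_norm f.
Proof.
move=> f delta fE f_supp small.
set S := [set x | f x != 0].
have card_S : #|S| = supp_size f by rewrite cardsE.
have S_small : (#|S| ^ 2 < 2 * p)%N.
  move: small; rewrite -f_supp -card_S -[X in X < _]ger0_norm // -sqrtr_sqr.
  rewrite ltr_sqrt ?mulr_gt0 ?ltr0n ?prime_gt0 //.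
  by rewrite -natrX -natrM ltr_nat.
have [a a_sep] : exists a : 'rV['F_p]_d,
    {in S &, injective (fun x => x *m a^T)}.
  apply: (@separating_functional 'F_p d S).
  rewrite card_Fp // bin2 ltn_half_double -mul2n.
  by apply: leq_ltn_trans S_small; rewrite expnS expn1 leq_mul2l leq_pred orbT.
have pd_gt0 : 0 < p%:R ^+ d :> R by rewrite exprn_gt0 // ltr0n prime_gt0.
rewrite -(ler_pM2l pd_gt0) -(sum_wiener_pushforward p_prime f a).
have -> : p%:R ^+ d * F p delta = \sum_(b : 'rV['F_p]_d) F p delta.
  by rewrite sumr_const card_mx card_Fp // mul1n -natrX mulr_natl.
apply: ler_sum => b _; apply: (F_bound _ _ _ _ small).
  exact: pushforward_range.
by rewrite supp_size_pushforward.
Qed.
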